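(* Let $m$ be a positive integer and let $C$ be an extremal binary doubly even self-dual $[24m,12m,4m+4]$ code. Then the support design $D$ of the minimum weight $4m+4$ of $C$ is not an $8$-design.
   Context: A binary linear code is self-dual if $C=C^\perp$ with respect to the standard inner product, and doubly even if all weights are divisible by $4$. An extremal binary doubly even self-dual $[24m,12m,4m+4]$ code has length $24m$, dimension $12m$ and minimum weight $4m+4$. The support of a codeword $c$ is the set of indices of its nonzero coordinates. The support design of $C$ for weight $w$ has the $24m$ coordinate indices as points and the supports of all codewords of weight $w$ as blocks. A $t$-design is a pair $(X,\mathcal{B})$ of a point set and a collection of $k$-subsets (blocks) such that every $t$-subset of $X$ lies in the same number $\lambda$ of blocks. *)

(* Defs.v *)
From HB Require Import structures.
From mathcomp Require Import all_boot all_order all_algebra.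

Set Implicit Arguments.
Unset Strict Implicit.
Unset Printing Implicit Defensive.

Import GRing.Theory.
Local Open Scope ring_scope.

Section Codes.

Variable n : nat.
Implicit Types (u v c : 'rV['F_2]_n) (C : {vspace 'rV['F_2]_n}).

Definition supp c : {set 'I_n} := [set i | c 0 i != 0].

Definition wt c : nat := #|supp c|.

Definition inner u v : 'F_2 := \sum_(i < n) u 0 i * v 0 i.

Definition dual_code C : {set 'rV['F_2]_n} :=
  [set v | [forall c, (c \in C) ==> (inner v c == 0)]].

Definition self_dual C : Prop := [set c | c \in C] = dual_code C.

Definition doubly_even C : Prop := forall c, c \in C -> (4 %| wt c)%N.

Definition has_min_weight C (d : nat) : Prop :=
  (exists c, [/\ c \in C, c != 0 & wt c = d]) /\
  (forall c, c \in C -> c != 0 -> (d <= wt c)%N).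

(* Distinct binary words have distinct supports, so a set of blocks loses no
   multiplicity. *)
Definition support_design C (w : nat) : {set {set 'I_n}} :=
  [set supp c | c : 'rV['F_2]_n & (c \in C) && (wt c == w)].

End Codes.

Definition extremal_code (m : nat) (C : {vspace 'rV['F_2]_(24 * m)}) : Prop :=
  [/\ self_dual C, doubly_even C, \dim C = (12 * m)%N
    & has_min_weight C (4 * m + 4)%N].

(* The point set is the whole finite type X. *)
Definition is_t_design (t : nat) (X : finType) (B : {set {set X}}) : Prop :=
  exists k lambda : nat,
    (forall b, b \in B -> #|b| = k) /\
    (forall T : {set X}, #|T| = t -> #|[set b in B | T \subset b]| = lambda).

(* Main.v *)
Require Import Defs.
From Stdlib Require Import ZArith Lia.

(** Write the weight enumerator as [h (t^4)].  MacWilliams duality makes [h] invariant under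
    [t |-> (1 - t)/(1 + t)], which forces [h] into the span of the [f^(m-r) g^r] with [r <= m],
    where [f = (1 + 14 X + X^2)^3] and [g = X (1 - X)^4] (Gleason).  For such an [h] and [s > m]
    the residue at 0 of the differential [d (h/f^m) / (g/f)^s] vanishes.  Taking [s = m + 1]
    and [s = m + 2] gives the numbers of words of weight [4m + 4] and [4m + 8], and the latter
    would be negative for [m >= 154] (Zhang).

    For [m <= 153], an 8-design determines the number [L s] of blocks through [s <= 8] points.
    Fix a block [b0], a point [p] in it and a point [q] outside.  A block [b] through [p] and
    [q] meets [b0] evenly, so [x = #|b :&: (b0 :\ p)|] is odd and [binomial ((x - 1)/2, 6)] is an
    integer.  Summing over [b] gives a congruence modulo 1024 between the [L s], which, together
    with the integrality of [L 8], excludes every [m <= 153]. *)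

(** * Integer inequalities and the finite check *)

Local Open Scope Z_scope.

Fixpoint rising (x : Z) (r : nat) : Z :=
  match r with O => 1 | S r => rising x r * (x + Z.of_nat r + 1) end.

Lemma rising_pos x r : 0 <= x -> 0 < rising x r.
Proof. intros x0; induction r as [|r IH]; cbn; [lia | nia]. Qed.

Lemma rising_add x r s : rising x (r + s) = rising x r * rising (x + Z.of_nat r) s.
Proof.
induction s as [|s IH]; [rewrite PeanoNat.Nat.add_0_r; cbn; ring|].
rewrite PeanoNat.Nat.add_succ_r; cbn; rewrite IH, Nat2Z.inj_add; ring.
Qed.

(** The ratio condition amounts to u r = u 0 * rising n r / rising p r. The [s] further factors put
    all [u r] with r + s fixed over one common denominator. *)
Lemma ratio_rising n p (u : nat -> Z) r s :
  (forall i, u (S i) * (p + Z.of_nat i + 1) = u i * (n + Z.of_nat i + 1)) ->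
  u r * rising p (r + s) = u O * (rising n r * rising (p + Z.of_nat r) s).
Proof.
intros ru; rewrite rising_add, Z.mul_assoc, Z.mul_assoc; f_equal.
induction r as [|r IH]; [reflexivity|]; cbn [rising].
rewrite Z.mul_comm, <- Z.mul_assoc, (Z.mul_comm _ (u (S r))), ru, Z.mul_assoc.
rewrite (Z.mul_comm _ (u r)), IH; ring.
Qed.

(* The coefficients on the two sides are those of f f' and f'. *)
Lemma zhang_ineq q (u v : nat -> Z) (m := q + 154) (n := 5 * m - 3) (p := m - 10) :
  0 <= q -> 0 < u O ->
  (forall r, u (S r) * (p + Z.of_nat r + 1) = u r * (n + Z.of_nat r + 1)) ->
  (forall r, v r * rising (p + Z.of_nat r) 4 = u r * rising (4 * m + 3) 4) ->
  (m + 1) *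
    (42 * u 11%nat + 2946 * u 10%nat + 82950 * u 9%nat + 1176030 * u 8%nat
     + 8481060 * u 7%nat + 26099028 * u 6%nat + 11873484 * u 5%nat
     + 2352060 * u 4%nat + 248850 * u 3%nat + 14730 * u 2%nat + 462 * u 1%nat + 6 * u O) <
  (4 * m * m + 54 * m + 92) *
    (42 * v 6%nat + 1182 * v 5%nat + 8484 * v 4%nat + 2364 * v 3%nat
     + 210 * v 2%nat + 6 * v 1%nat).
Proof.
intros q0 u0 ru rv.
assert (P0 : 0 < rising p 11) by (apply rising_pos; lia).
assert (hu : forall r s, (r + s = 11)%nat ->
  u r * rising p 11 = u O * (rising n r * rising (p + Z.of_nat r) s)).
  intros r s <-; apply ratio_rising, ru.
assert (hv : forall r s, (r + 4 + s = 11)%nat -> v r * rising p 11 =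
  u O * (rising n r * rising (4 * m + 3) 4 * rising (p + Z.of_nat r + 4) s)).
  intros r s rs.
  replace (rising p 11) with
    (rising p r * rising (p + Z.of_nat r) 4 * rising (p + Z.of_nat r + 4) s).
    replace (v r * _) with
      (v r * rising (p + Z.of_nat r) 4 * rising p r * rising (p + Z.of_nat r + 4) s) by ring.
    rewrite rv; assert (h := ratio_rising n p u r 0 ru).
    rewrite PeanoNat.Nat.add_0_r in h; cbn [rising] in h; rewrite Z.mul_1_r in h.
    replace (u r * _ * _) with (u r * rising p r * rising (4 * m + 3) 4) by ring.
    rewrite h; ring.
  rewrite <- rs, <- PeanoNat.Nat.add_assoc, rising_add, rising_add, Z.mul_assoc; reflexivity.
(* The factor [rising p 11] is a common denominator of all the [u r] and [v r] that occur. *)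
apply (Zmult_gt_0_lt_reg_r _ _ (rising p 11)); [lia|].
match goal with |- ?L * ?P < ?R * ?P =>
  replace (L * P) with ((m + 1) *
    (42 * (u 11%nat * P) + 2946 * (u 10%nat * P) + 82950 * (u 9%nat * P)
     + 1176030 * (u 8%nat * P) + 8481060 * (u 7%nat * P) + 26099028 * (u 6%nat * P)
     + 11873484 * (u 5%nat * P) + 2352060 * (u 4%nat * P) + 248850 * (u 3%nat * P)
     + 14730 * (u 2%nat * P) + 462 * (u 1%nat * P) + 6 * (u O * P))) by ring;
  replace (R * P) with ((4 * m * m + 54 * m + 92) *
    (42 * (v 6%nat * P) + 1182 * (v 5%nat * P) + 8484 * (v 4%nat * P)
     + 2364 * (v 3%nat * P) + 210 * (v 2%nat * P) + 6 * (v 1%nat * P))) by ring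
end.
rewrite (hu 11 0)%nat, (hu 10 1)%nat, (hu 9 2)%nat, (hu 8 3)%nat, (hu 7 4)%nat,
  (hu 6 5)%nat, (hu 5 6)%nat, (hu 4 7)%nat, (hu 3 8)%nat, (hu 2 9)%nat,
  (hu 1 10)%nat, (hu 0 11)%nat by reflexivity.
rewrite (hv 6 1)%nat, (hv 5 2)%nat, (hv 4 3)%nat, (hv 3 4)%nat, (hv 2 5)%nat,
  (hv 1 6)%nat by reflexivity.
(* After the shift m = q + 154 the difference is [u O] times a polynomial in q all of whose
   coefficients are positive. *)
apply Z.lt_0_sub; unfold n, p, m; cbn [rising Z.of_nat Pos.of_succ_nat Pos.succ].
match goal with |- 0 < ?D => replace D with (u O *
 (579837997405999745903445956320320000 + q * (1859322493885881895669076824423584000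
 + q * (142971629619469418693329698513561600 + q * (5083294033598928670385409550924800
 + q * (109779346053930917370260899270656 + q * (1601720578075207484471558342400
 + q * (16625857736026571730126312960 + q * (125869028398547186450488320
 + q * (700211517920314357598208 + q * (2840615358945088020480
 + q * (8195306312612413440 + q * (15960444903751680 + q * (18839016308736
 + q * 10192158720)))))))))))))) by ring end.
apply Z.mul_pos_pos; [exact u0|].
repeat (apply Z.add_pos_nonneg; [reflexivity|]; apply Z.mul_nonneg_nonneg; [exact q0|];
  try apply Z.lt_le_incl); lia.
Qed.

(** * Arithmetic conditions on an 8-design, tested for m <= 153 *)

Fixpoint falling (x : Z) (k : nat) : Z :=
  match k with O => 1 | S k => falling x k * (x - Z.of_nat k) end.

Lemma falling_pos x k : Z.of_nat k <= x -> 0 < falling x k.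
Proof. induction k as [|k IH]; intros kx; cbn [falling]; nia. Qed.

Fixpoint factZ (k : nat) : Z :=
  match k with O => 1 | S k' => factZ k' * Z.of_nat k end.

Lemma factZ_pos k : 0 < factZ k.
Proof. induction k as [|k IH]; cbn [factZ]; nia. Qed.

Lemma div_exact_eq a b c : 0 < b -> c * b = a -> a / b = c.
Proof. intros b0 <-; apply Z.div_mul; lia. Qed.

(* With c = binomial(5m + 3, m), each b_j is binomial(5m + 3 - j, m - j). *)
Definition min_count (m c : Z) : Z :=
  let b1 := c * m / (5 * m + 3) in
  let b2 := b1 * (m - 1) / (5 * m + 2) in
  let b3 := b2 * (m - 2) / (5 * m + 1) in
  let b4 := b3 * (m - 3) / (5 * m) in
  let b5 := b4 * (m - 4) / (5 * m - 1) in
  m * (42 * c + 1182 * b1 + 8484 * b2 + 2364 * b3 + 210 * b4 + 6 * b5) / (m + 1).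

(** The coefficients come from [bin_odd]. Summed over the blocks through p and q, binomial(x, l)
    becomes C l * L (l + 2), because l points of b0 are prescribed besides p and q. *)
Definition parity_sum (C L : nat -> Z) : Z :=
  231 * (C 0%nat * L 2%nat) - 231 * (C 1%nat * L 3%nat) + 210 * (C 2%nat * L 4%nat)
  - 168 * (C 3%nat * L 5%nat) + 112 * (C 4%nat * L 6%nat) - 56 * (C 5%nat * L 7%nat)
  + 16 * (C 6%nat * L 8%nat).

(** Two necessary conditions: the number [lam] of blocks through 8 points is an integer, and the
    parity sum is 0 modulo 1024. The other quotients are floor divisions, which are exact for an
    actual design. *)
Definition admissible (m c : Z) : bool :=
  let a := min_count m c in
  let N := a * falling (4 * m + 4) 8 in
  if N mod falling (24 * m) 8 =? 0 then
    let lam := N / falling (24 * m) 8 in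
    parity_sum (fun l => falling (4 * m + 3) l / factZ l)
      (fun s => lam * falling (24 * m - Z.of_nat s) (8 - s)
                / falling (4 * m + 4 - Z.of_nat s) (8 - s)) mod 1024 =? 0
  else false.

(** The hypotheses are the defining relations in multiplied form, so every division in [admissible]
    is exact and returns a, lam, [C l] or [L s] itself. *)
Lemma admissible_complete m a lam K (b C L : nat -> Z) : 1 <= m ->
  (forall j, (j < 5)%nat ->
     b (S j) * (5 * m + 3 - Z.of_nat j) = b j * (m - Z.of_nat j)) ->
  (m + 1) * a = m * (42 * b 0%nat + 1182 * b 1%nat + 8484 * b 2%nat
                     + 2364 * b 3%nat + 210 * b 4%nat + 6 * b 5%nat) ->
  a * falling (4 * m + 4) 8 = lam * falling (24 * m) 8 ->
  (forall s, (s <= 8)%nat -> L s * falling (4 * m + 4 - Z.of_nat s) (8 - s) =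
     lam * falling (24 * m - Z.of_nat s) (8 - s)) ->
  (forall l, C l * factZ l = falling (4 * m + 3) l) ->
  parity_sum C L = 1024 * K ->
  admissible m (b 0%nat) = true.
Proof.
intros m1 hb ha hl hL hC hK.
assert (ea : min_count m (b 0%nat) = a).
  unfold min_count.
  rewrite (div_exact_eq (b 0%nat * m) (5 * m + 3) (b 1%nat)); [|lia|generalize (hb 0%nat); lia].
  rewrite (div_exact_eq _ (5 * m + 2) (b 2%nat)); [|lia|generalize (hb 1%nat); lia].
  rewrite (div_exact_eq _ (5 * m + 1) (b 3%nat)); [|lia|generalize (hb 2%nat); lia].
  rewrite (div_exact_eq _ (5 * m) (b 4%nat)); [|lia|generalize (hb 3%nat); lia].
  rewrite (div_exact_eq _ (5 * m - 1) (b 5%nat)); [|lia|generalize (hb 4%nat); lia].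
  apply div_exact_eq; lia.
unfold admissible; rewrite ea, hl.
assert (n0 : 0 < falling (24 * m) 8) by (apply falling_pos; lia).
rewrite Z.mod_mul, Z.eqb_refl, Z.div_mul by lia.
assert (eC : forall l, falling (4 * m + 3) l / factZ l = C l).
  intros l; apply div_exact_eq; [apply factZ_pos|apply hC].
assert (eL : forall s, (s <= 8)%nat -> lam * falling (24 * m - Z.of_nat s) (8 - s)
    / falling (4 * m + 4 - Z.of_nat s) (8 - s) = L s).
  intros s s8; apply div_exact_eq; [apply falling_pos; lia|apply hL, s8].
unfold parity_sum; rewrite !eC, !eL by lia; fold (parity_sum C L).
rewrite hK, Z.mul_comm, Z.mod_mul by lia; reflexivity.
Qed.

(* [c] runs through the binomial coefficients binomial(5m + 3, m). *)
Fixpoint none_admissible (k : nat) (m c : Z) : bool :=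
  match k with
  | O => true
  | S k =>
      negb (admissible m c) &&
      none_admissible k (m + 1)
        (c * ((5 * m + 4) * (5 * m + 5) * (5 * m + 6) * (5 * m + 7) * (5 * m + 8))
           / ((m + 1) * ((4 * m + 4) * (4 * m + 5) * (4 * m + 6) * (4 * m + 7))))
  end.

(** The scan starts at m = 1, where binomial(5m + 3, m) is 8. *)
Lemma none_admissible_le_153 : none_admissible 153 1 8 = true.
Proof. vm_compute; reflexivity. Qed.

Lemma none_admissible_sound (c : nat -> Z) k m :
  (forall i, c (S i) * ((Z.of_nat i + 1) * ((4 * Z.of_nat i + 4) * (4 * Z.of_nat i + 5)
                * (4 * Z.of_nat i + 6) * (4 * Z.of_nat i + 7))) =
     c i * ((5 * Z.of_nat i + 4) * (5 * Z.of_nat i + 5) * (5 * Z.of_nat i + 6)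
            * (5 * Z.of_nat i + 7) * (5 * Z.of_nat i + 8))) ->
  none_admissible k (Z.of_nat m) (c m) = true ->
  forall i, (m <= i < m + k)%nat -> admissible (Z.of_nat i) (c i) = false.
Proof.
intros rc; revert m; induction k as [|k IH]; intros m; [lia|].
cbn [none_admissible]; rewrite Bool.andb_true_iff; intros [h1 h2] i hi.
destruct (Nat.eq_dec m i) as [<-|ne]; [now destruct (admissible _ _)|].
apply (IH (S m)); [|lia].
rewrite (div_exact_eq _ _ (c (S m))) in h2; [|nia|apply rc].
now rewrite Nat2Z.inj_succ.
Qed.

Close Scope Z_scope.

From HB Require Import structures.
From mathcomp Require Import all_boot all_order all_algebra.
From mathcomp Require Import ring lra zify.

Set Implicit Arguments.
Unset Strict Implicit.
Unset Printing Implicit Defensive.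

Import Order.TTheory GRing.Theory Num.Theory.
Delimit Scope Z_scope with coqZ.

(** * Counting in designs *)

Definition blocks_above (X : finType) (B : {set {set X}}) (U : {set X}) :=
  [set b in B | U \subset b].

Lemma card_between (X : finType) (U b : {set X}) t : U \subset b -> #|U| <= t ->
  #|[set T : {set X} | [&& U \subset T, T \subset b & #|T| == t]]| =
    'C(#|b| - #|U|, t - #|U|).
Proof.
move=> Ub Ut; rewrite -(cardsDS Ub) -(cards_draws (b :\: U)).
rewrite -[RHS](card_in_imset (f := fun V => U :|: V)); last first.
  move=> V W; rewrite !inE => /andP[Vs _] /andP[Ws _] e.
  have disj (Z : {set X}) : Z \subset b :\: U -> (U :|: Z) :\: U = Z.
    move=> Zs; rewrite setDUl setDv set0U; apply/setDidPl.
    apply: disjointWl Zs _; rewrite disjoint_sym disjoints_subset subsetC.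
    by apply/subsetP => x; rewrite !inE => /andP[].
  by rewrite -(disj V) // -(disj W) // e.
apply: eq_card => T; rewrite inE; apply/and3P/imsetP => [[UT Tb /eqP Tt]|[V]].
  exists (T :\: U); last by rewrite setDE setUIr setUCr setIT; apply/esym/setUidPr.
  by rewrite inE setSD //= cardsDS // Tt.
rewrite inE => /andP[Vs /eqP Vc] ->.
have dUV : [disjoint U & V].
  rewrite disjoint_sym; apply: disjointWl Vs _.
  by rewrite disjoint_sym disjoints_subset; apply/subsetP => x xU; rewrite !inE xU.
split; first exact: subsetUl.
  by rewrite subUset Ub; apply: subset_trans Vs (subsetDl _ _).
by rewrite cardsU disjoint_setI0 // cards0 subn0 Vc subnKC.
Qed.

(** Double counting of the pairs (T, b) with U inside T, T inside b and T of size t. Falling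
    factorials replace binomials after multiplication by the factorial of t - #|U|. *)
Lemma card_blocks_above (X : finType) (B : {set {set X}}) t d lam (U : {set X}) :
  (forall b, b \in B -> #|b| = d) ->
  (forall T : {set X}, #|T| = t -> #|blocks_above B T| = lam) ->
  #|U| <= t ->
  #|blocks_above B U| * (d - #|U|) ^_ (t - #|U|) = lam * (#|X| - #|U|) ^_ (t - #|U|).
Proof.
move=> Bd Bt Ut; rewrite -!bin_ffact !mulnA; congr (_ * _).
pose P (T b : {set X}) := [&& b \in B, U \subset T, T \subset b & #|T| == t].
transitivity (\sum_(b : {set X}) \sum_(T : {set X}) P T b); last first.
  rewrite exchange_big /=.
  rewrite (bigID (fun T : {set X} => (U \subset T) && (#|T| == t))) /= addnC big1 => [|T].
    rewrite add0n; transitivity (\sum_(T : {set X} | (U \subset T) && (#|T| == t)) lam).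
      apply: eq_bigr => T /andP[UT /eqP Tt].
      rewrite -(Bt T Tt) -sum1_card big_mkcond [RHS]big_mkcond /=; apply: eq_bigr => b _.
      by rewrite /P !inE UT Tt eqxx !andbT /=; case: (b \in B); case: (_ \subset _).
    rewrite sum_nat_const mulnC; congr (_ * _).
    rewrite -(cardsT X) -(card_between (subsetT U) Ut).
    by apply: eq_card => T; rewrite !inE subsetT.
  rewrite /P => nT; apply: big1 => b _.
  by case: (U \subset T) nT => //= [/negbTE->|_]; rewrite ?andbF.
rewrite (bigID (fun b => b \in blocks_above B U)) /= [X in _ = _ + X]big1 ?addn0 => [|b].
  rewrite -sum_nat_const; apply: eq_bigr => b; rewrite inE => /andP[bB Ub].
  rewrite -(Bd b bB) -(card_between Ub Ut) -sum1_card big_mkcond /=.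
  by apply: eq_bigr => T _; rewrite /P inE bB /=; case: ifP.
rewrite inE negb_and => nb; apply: big1 => T _; rewrite /P.
case: (b \in B) nb => //= nb; case UT: (U \subset T) => //=; case Tb: (T \subset b) => //=.
by rewrite (subset_trans UT Tb) in nb.
Qed.

(** Double counting of the pairs (U, b) with U an l-subset of b :&: S. *)
Lemma sum_bin_inter (X : finType) (D : {set {set X}}) (S : {set X}) l :
  \sum_(b in D) 'C(#|b :&: S|, l) =
  \sum_(U : {set X} | (U \subset S) && (#|U| == l)) #|blocks_above D U|.
Proof.
transitivity (\sum_(b in D) \sum_(U : {set X} | (U \subset S) && (#|U| == l)) (U \subset b)).
  apply: eq_bigr => b _; rewrite -cards_draws -sum1_card big_mkcond [RHS]big_mkcond /=.
  apply: eq_bigr => U _; rewrite inE subsetI.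
  by case: (U \subset S); case: (U \subset b); case: (_ == _).
rewrite exchange_big /=; apply: eq_bigr => U _.
rewrite -sum1_card big_mkcond [RHS]big_mkcond /=; apply: eq_bigr => b _.
by rewrite inE; case: (b \in D); case: (_ \subset _).
Qed.

(* The expansion of binomial((x - 1)/2, 6) in the basis binomial(x, l), cleared of denominators
   and with the negative terms moved to the other side. *)
Lemma bin_odd x y : x = y.*2.+1 ->
  231 * 'C(x, 0) + 210 * 'C(x, 2) + 112 * 'C(x, 4) + 16 * 'C(x, 6) =
  1024 * 'C(y, 6) + (231 * 'C(x, 1) + 168 * 'C(x, 3) + 56 * 'C(x, 5)).
Proof.
(* Over [rat] every binomial becomes a polynomial in y, and the claim is a polynomial identity. *)
move=> xy; apply/eqP; rewrite -(eqr_nat rat); apply/eqP.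
have rec n k : ('C(n, k.+1)%:R = (n%:R - k%:R) / k.+1%:R * 'C(n, k)%:R :> rat)%R.
  have kn : (k.+1%:R != 0 :> rat)%R by rewrite pnatr_eq0.
  apply: (mulfI kn).
  rewrite [RHS](_ : _ = (n%:R - k%:R) * 'C(n, k)%:R)%R; last by field; rewrite addrC natr1.
  rewrite -natrM mul_bin_left; case: (leqP k n) => kn'.
    by rewrite natrM natrB.
  by rewrite bin_small // muln0 mulr0.
have xE : (x%:R = 2 * y%:R + 1 :> rat)%R by rewrite xy -natr1 -muln2 natrM mulrC.
transitivity (231 * 'C(x, 0)%:R + 210 * 'C(x, 2)%:R + 112 * 'C(x, 4)%:R + 16 * 'C(x, 6)%:R : rat)%R.
  by ring.
transitivity (1024 * 'C(y, 6)%:R +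
    (231 * 'C(x, 1)%:R + 168 * 'C(x, 3)%:R + 56 * 'C(x, 5)%:R) : rat)%R; last by ring.
rewrite !rec !bin0 xE; move: (y%:R)%R => {xE} z.
by field.
Qed.

Lemma design_parity (X : finType) (B : {set {set X}}) d lam (b0 : {set X}) :
  (forall b, b \in B -> #|b| = d) ->
  (forall T : {set X}, #|T| = 8 -> #|blocks_above B T| = lam) ->
  b0 \in B -> 8 <= d < #|X| -> (forall b, b \in B -> ~~ odd #|b :&: b0|) ->
  exists (K : nat) (L : nat -> nat),
    (forall s, s <= 8 -> L s * (d - s) ^_ (8 - s) = lam * (#|X| - s) ^_ (8 - s)) /\
    231 * ('C(d - 1, 0) * L 2) + 210 * ('C(d - 1, 2) * L 4)
      + 112 * ('C(d - 1, 4) * L 6) + 16 * ('C(d - 1, 6) * L 8) =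
    1024 * K + (231 * ('C(d - 1, 1) * L 3) + 168 * ('C(d - 1, 3) * L 5)
      + 56 * ('C(d - 1, 5) * L 7)).
Proof.
move=> Bd Bt b0B /andP[d8 dX] Beven.
pose L s := (lam * (#|X| - s) ^_ (8 - s)) %/ (d - s) ^_ (8 - s).
have LU (U : {set X}) : #|U| <= 8 -> #|blocks_above B U| = L #|U|.
  move=> U8; rewrite /L -(card_blocks_above Bd Bt U8) mulnK // ffact_gt0.
  exact: leq_sub2r.
have Ls s : s <= 8 -> L s * (d - s) ^_ (8 - s) = lam * (#|X| - s) ^_ (8 - s).
  move=> s8; have : 0 < #|[set U : {set X} | (U \subset [set: X]) && (#|U| == s)]|.
    by rewrite cards_draws cardsT bin_gt0; lia.
  case/card_gt0P => U; rewrite inE => /andP[_ /eqP Us].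
  by rewrite -Us in s8 *; rewrite -LU // (card_blocks_above Bd Bt).
have [p pb0] : exists p, p \in b0 by apply/card_gt0P; rewrite (Bd _ b0B); lia.
have [q qb0] : exists q, q \notin b0.
  have /card_gt0P[q] : 0 < #|~: b0| by have := cardsC b0; rewrite (Bd _ b0B); lia.
  by rewrite inE => ?; exists q.
have pq : p != q by apply: contraNneq qb0 => <-.
pose D := [set b in B | (p \in b) && (q \in b)]; pose S := b0 :\ p.
have Sd : #|S| = d - 1 by rewrite -(Bd _ b0B) (cardsD1 p b0) pb0 addKn.
(* Since p is not in S and q is not in b0, an l-subset of S together with p and q has l + 2 points.
   The bound l <= 6 keeps this within the strength 8 of the design. *)
have F l : l <= 6 -> \sum_(b in D) 'C(#|b :&: S|, l) = 'C(d - 1, l) * L l.+2.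
  move=> l6; rewrite sum_bin_inter -Sd -cards_draws -sum_nat_const.
  apply: eq_big => [U|U]; rewrite ?inE // => /andP[US /eqP Ul].
  have pU : p \notin U by apply/negP => /(subsetP US); rewrite !inE eqxx.
  have qU : q \notin U by apply/negP => /(subsetP US); rewrite !inE (negbTE qb0) andbF.
  have cU : #|p |: (q |: U)| = l.+2 by rewrite !cardsU1 !inE negb_or pq pU qU Ul.
  rewrite -cU -LU ?cU //; apply: eq_card => b; rewrite !inE !subUset !sub1set.
  by rewrite !andbA.
(* The intersection of b with b0 is even and contains p, so removing p leaves an odd number of
   points. *)
have odd_inter b : b \in D -> #|b :&: S| = (#|b :&: S|./2).*2.+1.
  rewrite inE => /andP[bB /andP[pb _]]; have := Beven b bB.
  rewrite (cardsD1 p) inE pb pb0 /= negbK -setIDA -/S => o.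
  by rewrite -{1}(odd_double_half #|b :&: S|) o.
exists (\sum_(b in D) 'C(#|b :&: S|./2, 6)), L; split=> //.
rewrite -!F // !big_distrr -!big_split /=.
by apply: eq_bigr => b bD; apply: bin_odd; apply: odd_inter.
Qed.

Local Open Scope ring_scope.

(** * The MacWilliams identity *)

(** This is the nontrivial additive character of F_2. *)
Definition chi (a : 'F_2) : rat := if a == 0 then 1 else -1.

Lemma F2P (a : 'F_2) : a = 0 \/ a = 1.
Proof.
by case: a => [[|[|k]] lek] //; [left|right]; apply/val_inj.
Qed.

Lemma chiD (a b : 'F_2) : chi (a + b) = chi a * chi b.
Proof.
by case: (F2P a) => ->; case: (F2P b) => ->;
  rewrite /chi ?addr0 ?add0r ?mulr1 ?mul1r // mulrNN mulr1.
Qed.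

Lemma chi_sum (I : finType) (F : I -> 'F_2) :
  chi (\sum_i F i) = \prod_i chi (F i).
Proof. by apply: big_morph => //; exact: chiD. Qed.

Lemma innerDl n (u v w : 'rV['F_2]_n) : inner (u + v) w = inner u w + inner v w.
Proof.
by rewrite /inner -big_split; apply: eq_bigr => i _; rewrite mxE mulrDl.
Qed.

Lemma innerC n (u v : 'rV['F_2]_n) : inner u v = inner v u.
Proof. by apply: eq_bigr => i _; rewrite mulrC. Qed.

Lemma chi_inner_sum n (C : {vspace 'rV['F_2]_n}) (v : 'rV['F_2]_n) :
  \sum_(c in C) chi (inner c v) =
    if v \in dual_code C then (#|[set c in C]|)%:R else 0.
Proof.
case: ifP => [|/negbT]; rewrite inE.
  move=> /forallP vC; rewrite -sum1_card natr_sum.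
  apply: eq_big => [c|c cC]; first by rewrite inE.
  by move: (vC c); rewrite cC innerC /= /chi => ->.
rewrite negb_forall => /existsP[c0]; rewrite negb_imply => /andP[c0C nz].
have chi0 : chi (inner c0 v) = -1 by rewrite /chi innerC (negbTE nz).
(* Translation by [c0] permutes C and changes the sign of every term, so S = - S. *)
set S := \sum_(c in C) _; suff : S = - S by move/eqP; rewrite -addr_eq0 -mulr2n mulrn_eq0 => /eqP.
rewrite {1}/S (reindex_inj (addrI c0)) /= -sumrN.
apply: eq_big => [c|c _]; last by rewrite innerDl chiD chi0 mulN1r.
by apply/idP/idP => [h|]; [rewrite -(addKr c0 c) rpredD ?rpredN | apply: rpredD].
Qed.

Lemma prod_wt n (u : 'rV['F_2]_n) (a b : rat) :
  \prod_(i < n) (if u 0 i == 0 then a else b) = a ^+ (n - wt u) * b ^+ wt u.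
Proof.
rewrite (bigID (fun i => u 0 i == 0)) /=; congr (_ * _).
  rewrite (eq_bigr (fun=> a)) => [|i ->//]; rewrite prodr_const; congr (_ ^+ _).
  have <- : (wt u + #|~: supp u| - wt u = n - wt u)%N by rewrite cardsC card_ord.
  by rewrite addKn; apply: eq_card => i; rewrite !inE negbK.
rewrite (eq_bigr (fun=> b)) => [|i /negbTE->//]; rewrite prodr_const.
by congr (_ ^+ _); apply: eq_card => i; rewrite !inE.
Qed.

Lemma wt_le n (u : 'rV['F_2]_n) : (wt u <= n)%N.
Proof. by have := max_card (supp u); rewrite card_ord. Qed.

(** The sum over all words factors over the coordinates: coordinate i contributes 1 + t if u
    vanishes there and 1 - t otherwise. *)
Lemma krawtchouk_sum n (u : 'rV['F_2]_n) (t : rat) :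
  \sum_(v : 'rV['F_2]_n) chi (inner u v) * t ^+ wt v =
    (1 + t) ^+ (n - wt u) * (1 - t) ^+ wt u.
Proof.
pose F i (a : 'F_2) := chi (u 0 i * a) * (if a == 0 then 1 else t).
have prodF i : \sum_a F i a = if u 0 i == 0 then 1 + t else 1 - t.
  rewrite /F !big_ord_recl big_ord0 addr0 /= /chi.
  by case: (F2P (u 0 i)) => ->; rewrite ?mulr0 ?mul0r ?mulr1 ?mul1r ?eqxx ?mul1r ?mulN1r //=.
rewrite -prod_wt -(eq_bigr _ (fun i _ => prodF i)) bigA_distr_bigA /=.
rewrite (reindex (fun f : {ffun 'I_n -> 'F_2} => \row_i f i)) /=; last first.
  exists (fun v : 'rV_n => [ffun i => v 0 i]) => [f _|v _].
    by apply/ffunP => i; rewrite ffunE mxE.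
  by apply/rowP => i; rewrite mxE ffunE.
apply: eq_bigr => f _; rewrite /F big_split /= -chi_sum; congr (chi _ * _).
  by apply: eq_bigr => i _; rewrite mxE.
have := prod_wt (\row_i f i) 1 t; rewrite expr1n mul1r => <-.
by apply: eq_bigr => i _; rewrite mxE.
Qed.

Lemma macwilliams n (C : {vspace 'rV['F_2]_n}) (t : rat) :
  \sum_(c in C) (1 + t) ^+ (n - wt c) * (1 - t) ^+ wt c =
    (#|[set c in C]|)%:R * \sum_(v in dual_code C) t ^+ wt v.
Proof.
under eq_bigr => c _ do rewrite -krawtchouk_sum.
rewrite exchange_big /= mulr_sumr [RHS]big_mkcond /=.
apply: eq_bigr => v _; rewrite -mulr_suml chi_inner_sum.
by case: ifP => // _; rewrite mul0r.
Qed.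

Lemma wt0 n : wt (0 : 'rV['F_2]_n) = 0%N.
Proof. by apply/eqP; rewrite cards_eq0; apply/eqP/setP => i; rewrite !inE mxE eqxx. Qed.

Lemma wt_eq0 n (c : 'rV['F_2]_n) : (wt c == 0%N) = (c == 0).
Proof.
apply/idP/eqP => [|->]; last by rewrite wt0.
rewrite cards_eq0 => /eqP s0; apply/rowP => i; rewrite mxE; apply/eqP.
by have /setP/(_ i) := s0; rewrite !inE => /negbFE.
Qed.

(** At t = 1 only the zero word survives on the left of the MacWilliams identity, and the right side
    is the square of the number of words. *)
Lemma card_self_dual n (C : {vspace 'rV['F_2]_n}) :
  self_dual C -> (#|[set c in C]| ^ 2 = 2 ^ n)%N.
Proof.
move=> sdC; have := macwilliams C 1; rewrite subrr -sdC.
under [X in _ = _ * X]eq_bigr => v _ do rewrite expr1n.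
rewrite sumr_const -natrM (bigD1 0) ?mem0v //= wt0 subn0 expr0 mulr1 big1 => [|c].
  by rewrite addr0 -[1 + 1]/(2%:R) -natrX; move/eqP; rewrite eqr_nat -mulnn => /eqP ->.
by case/andP=> _; rewrite -wt_eq0 => /negbTE c0; rewrite expr0n c0 mulr0.
Qed.

Lemma card_self_dual_half n k (C : {vspace 'rV['F_2]_n}) :
  n = (k * 2)%N -> self_dual C -> #|[set c in C]| = (2 ^ k)%N.
Proof.
by move=> nk /card_self_dual; rewrite [in RHS]nk expnM => /eqP; rewrite eqn_sqr => /eqP.
Qed.

(* (1 + t)^n W((1 - t)/(1 + t)) for the weight enumerator W *)
Lemma macwilliams_eval n (C : {vspace 'rV['F_2]_n}) (t : rat) : t != -1 ->
  (1 + t) ^+ n * \sum_(c in C) ((1 - t) / (1 + t)) ^+ wt c =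
    (#|[set c in C]|)%:R * \sum_(v in dual_code C) t ^+ wt v.
Proof.
move=> tN1; rewrite -macwilliams mulr_sumr; apply: eq_bigr => c _.
have t1 : 1 + t != 0 by rewrite addrC addr_eq0.
rewrite expr_div_n -{1}(subnK (wt_le c)) exprD -mulrA; congr (_ * _).
by rewrite mulrC divfK // expf_neq0.
Qed.

(** * Gleason's theorem *)

(** Here f (t^4) is the cube of 1 + 14 t^4 + t^8, the weight enumerator of the extended Hamming code
    of length 8. *)
Definition gleason_f : {poly rat} := (1 + 14%:R *: 'X + 'X^2) ^+ 3.
Definition gleason_g : {poly rat} := 'X * (1 - 'X) ^+ 4.

(* Invariance of h (t^4), as a form of degree 24m, under the MacWilliams transform. *)
Definition selfdual_poly (m : nat) (h : {poly rat}) : Prop := forall t : rat, t != -1 ->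
  (1 + t) ^+ (24 * m) * h.[((1 - t) / (1 + t)) ^+ 4] = 2 ^+ (12 * m) * h.[t ^+ 4].

Lemma selfdual_poly1 : selfdual_poly 0 1.
Proof. by move=> t _; rewrite !muln0 !hornerC. Qed.

Lemma selfdual_polyM a b p q :
  selfdual_poly a p -> selfdual_poly b q -> selfdual_poly (a + b) (p * q).
Proof.
move=> ip iq t tN1; rewrite !hornerM !mulnDr (exprD _ (24 * a)) (exprD _ (12 * a)).
by rewrite mulrACA (ip t) // (iq t) // mulrACA.
Qed.

Lemma selfdual_polyX a p : selfdual_poly 1 p -> selfdual_poly a (p ^+ a).
Proof.
move=> ip; elim: a => [|a IH]; first exact: selfdual_poly1.
by rewrite exprS -addn1 addnC; apply: selfdual_polyM.
Qed.

Lemma selfdual_polyB m p q c :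
  selfdual_poly m p -> selfdual_poly m q -> selfdual_poly m (p - c *: q).
Proof.
by move=> ip iq t tN1; rewrite !hornerD !hornerN !hornerZ !mulrBr !(mulrCA _ c) ip ?iq.
Qed.

Lemma neqN1_addr (t : rat) : t != -1 -> 1 + t != 0.
Proof. by rewrite addrC addr_eq0. Qed.

Lemma selfdual_poly_f : selfdual_poly 1 gleason_f.
Proof.
move=> t /neqN1_addr tN1; rewrite /gleason_f !horner_exp.
set p := 1 + _ + _.
have key : (1 + t) ^+ 8 * p.[((1 - t) / (1 + t)) ^+ 4] = 2 ^+ 4 * p.[t ^+ 4].
  rewrite /p !(hornerD, hornerZ, hornerX, hornerXn, hornerC); field.
  exact: tN1.
have -> : (24 * 1 = 8 * 3)%N by [].
have -> : (12 * 1 = 4 * 3)%N by [].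
by rewrite (exprM (1 + t)) (exprM 2) -exprMn key exprMn.
Qed.

Lemma selfdual_poly_g : selfdual_poly 1 gleason_g.
Proof.
move=> t /neqN1_addr tN1; rewrite /gleason_g !(hornerM, horner_exp).
rewrite !(hornerD, hornerN, hornerX, hornerC).
(* The form t (1 - t^4) of degree 6 is itself invariant, and g (t^4) is its fourth power. *)
have key : (1 + t) ^+ 6 * ((1 - t) / (1 + t) * (1 - ((1 - t) / (1 + t)) ^+ 4)) =
    2 ^+ 3 * (t * (1 - t ^+ 4)).
  field; exact: tN1.
have -> : (24 * 1 = 6 * 4)%N by [].
have -> : (12 * 1 = 3 * 4)%N by [].
rewrite (exprM (1 + t)) (exprM 2) -[X in _ * X = _]exprMn -[LHS]exprMn key exprMn.
by rewrite [in LHS](exprMn 4 t).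
Qed.

Lemma selfdual_poly_gleason m r : (r <= m)%N ->
  selfdual_poly m (gleason_f ^+ (m - r) * gleason_g ^+ r).
Proof.
move=> rm; rewrite -{1}(subnK rm).
by apply: selfdual_polyM; apply: selfdual_polyX; [exact: selfdual_poly_f | exact: selfdual_poly_g].
Qed.

(** If p - q were nonzero, the fourth powers of 1, ..., size (p - q) would be more roots than its
    degree allows. *)
Lemma poly_eq_pow4 (p q : {poly rat}) :
  (forall t, 0 < t -> p.[t ^+ 4] = q.[t ^+ 4]) -> p = q.
Proof.
move=> pq; apply/eqP; rewrite -subr_eq0; apply/negPn/negP => nz.
pose s := [seq (i.+1)%:R ^+ 4 : rat | i <- iota 0 (size (p - q))].
have roots_s : all (root (p - q)) s.
  by apply/allP => x /mapP[i _ ->]; rewrite rootE hornerD hornerN pq ?subrr // ltr0Sn.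
have uniq_s : uniq s.
  rewrite map_inj_uniq ?iota_uniq // => i j /(pexpIrn (isT : (0 < 4)%N)) ij.
  by apply/succn_inj/eqP; rewrite -(eqr_nat rat); apply/eqP/ij; rewrite nnegrE ler0n.
by have := max_poly_roots nz roots_s uniq_s; rewrite size_map size_iota ltnn.
Qed.

(* The transformations t |-> (1 - t)/(1 + t) and t |-> - t generate t |-> 1/t. *)
Lemma selfdual_poly_inv m h (t : rat) : selfdual_poly m h -> 0 < t ->
  t ^+ (24 * m) * h.[t ^- 4] = h.[t ^+ 4].
Proof.
move=> ih t0; have tN : 1 + t != 0 by lra.
have tN1 : t != -1 by lra.
pose s := (1 - t) / (1 + t).
have sE : 1 - s = 2 * t / (1 + t) by rewrite /s; field.
have sN1 : - s != - 1.
  by rewrite eqr_opp eq_sym -subr_eq0 sE !mulf_neq0 ?invr_neq0 //; lra.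
have st : ((1 - - s) / (1 + - s)) ^+ 4 = t ^- 4.
  by rewrite -exprVn; congr (_ ^+ _); rewrite /s; field; rewrite tN; apply/andP; split => //; lra.
have e1 := ih t tN1; have := ih (- s) sN1; rewrite -[1 + - s]/(1 - s) => e2.
have s4 : (- s) ^+ 4 = s ^+ 4 by ring.
rewrite st s4 sE in e2; rewrite -/s in e1.
have : (2 ^+ (12 * m)) ^+ 2 * (t ^+ (24 * m) * h.[t ^- 4]) = (2 ^+ (12 * m)) ^+ 2 * h.[t ^+ 4].
  rewrite [in RHS]expr2 -[RHS]mulrA -e1 [RHS]mulrCA -e2 -exprM.
  have -> : (12 * m * 2 = 24 * m)%N by lia.
  by rewrite 2!mulrA -exprMn -[in RHS]exprMn; congr (_ ^+ _ * _); field.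
by apply: mulfI; rewrite !expf_neq0.
Qed.

(** Invariance under t |-> 1/t, in degree 24m, makes h palindromic. *)
Lemma selfdual_poly_coef_rev m h k : selfdual_poly m h -> (size h <= (6 * m).+1)%N ->
  (k <= 6 * m)%N -> h`_k = h`_(6 * m - k).
Proof.
move=> ih sz km; pose r := \poly_(k < (6 * m).+1) h`_(6 * m - k).
suff e : h = r by rewrite {1}e coef_poly ltnS km.
apply: poly_eq_pow4 => t t0; have tn0 : t != 0 by rewrite gt_eqF.
rewrite -(selfdual_poly_inv ih t0) (horner_coef_wide _ sz) horner_poly mulr_sumr.
rewrite (reindex_inj rev_ord_inj); apply: eq_bigr => i _ /=; rewrite subSS mulrCA; congr (_ * _).
have im : (i <= 6 * m)%N by rewrite -ltnS.
have -> : (24 * m = 4 * (6 * m - i) + 4 * i)%N by lia.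
rewrite exprD (exprM _ 4 i) exprVn -(exprM t 4 (6 * m - i)) mulrAC divff ?mul1r // expf_neq0 //.
Qed.

(** In X^4 - 1 = (X^3 + X^2 + X + 1) (X - 1) the first factor does not vanish at 1, so substituting
    X^4 leaves the multiplicity of the root 1 unchanged. *)
Lemma dvdp_comp_pow4 e (h : {poly rat}) :
  ('X - 1%:P) ^+ e %| h \Po 'X^4 -> ('X - 1%:P) ^+ e %| h.
Proof.
elim: e h => [|e IH] h; first by rewrite !expr0 !dvd1p.
move=> dv; have : root h 1.
  have /dvdp_trans/(_ dv) : ('X - 1%:P : {poly rat}) %| ('X - 1%:P) ^+ e.+1.
    by rewrite exprS dvdp_mulr.
  by rewrite -root_factor_theorem !rootE horner_comp hornerXn expr1n.
move=> /factor_theorem[q hq]; move: dv; rewrite hq comp_polyM comp_polyB comp_polyX comp_polyC.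
have -> : 'X^4 - 1%:P = ('X^3 + 'X^2 + 'X + 1%:P) * ('X - 1%:P) :> {poly rat}.
  by rewrite !polyC1; ring.
rewrite mulrA !(exprSr _ e) !dvdp_mul2r ?polyXsubC_eq0 //.
rewrite Gauss_dvdpl; first exact: IH.
apply: coprimep_expl; rewrite coprimep_sym coprimep_XsubC rootE !hornerE.
by [].
Qed.

(** By palindromy h = X^(m+1) q with size q <= 4m - 1. The transform exchanges t = 0 and t = 1, so
    the zero of h (t^4) of order 4 (m + 1) at 0 reappears at 1. Thus (X - 1)^(4m+4) divides q, which
    is too small unless it is zero. *)
Lemma selfdual_poly_low0 m h : selfdual_poly m h -> (size h <= (6 * m).+1)%N ->
  (forall i, (i <= m)%N -> h`_i = 0) -> h = 0.
Proof.
move=> ih sz low.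
have szh : (size h <= 5 * m)%N.
  apply/leq_sizeP => j jm; case: (leqP j (6 * m)) => [j6|/(leq_sizeP _ _ sz)//].
  by rewrite (selfdual_poly_coef_rev ih sz j6) low //; lia.
pose q := drop_poly m.+1 h.
have hq : h = q * 'X^(m.+1).
  rewrite -[h in LHS](poly_take_drop m.+1) [take_poly _ _](_ : _ = 0) ?add0r //.
  by apply/polyP => i; rewrite coef_take_poly coef0; case: ltnP => // /low.
have szq : (size q <= 4 * m - 1)%N by rewrite size_drop_poly; lia.
have : ('X - 1%:P) ^+ (4 * m.+1) %| h \Po 'X^4.
  (* This is what the left side of the invariance leaves once (1 - t)^(4m+4) is taken out. The
     exponents of 1 + t do not truncate, because j < 4m - 1. *)
  pose Q := \sum_(j < size q) q`_j *:
    ((1 - 'X) ^+ (4 * j) * (1 + 'X) ^+ (24 * m - 4 * m.+1 - 4 * j)).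
  suff e : 2 ^+ (12 * m) *: (h \Po 'X^4) = ('X - 1%:P) ^+ (4 * m.+1) * Q.
    by rewrite -(dvdpZr _ _ (_ : 2 ^+ (12 * m) != 0 :> rat)) ?expf_neq0 // e dvdp_mulr.
  apply: poly_eq_pow4 => s s0; have : 0 < s ^+ 4 by rewrite exprn_gt0.
  move: (s ^+ 4) => t t0.
  have tN1 : t != -1 by clear -t0; lra.
  rewrite hornerZ horner_comp hornerXn -(ih t tN1) hq.
  rewrite !(hornerM, horner_exp, hornerD, hornerN, hornerX, hornerXn, hornerC).
  rewrite -[q in LHS]coefK horner_poly horner_sum mulr_suml !mulr_sumr; apply: eq_bigr => j _.
  rewrite !(hornerZ, hornerM, horner_exp, hornerD, hornerN, hornerX, hornerC) -!exprM.
  have jq := ltn_ord j.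
  have -> : ((t - 1) ^+ (4 * m.+1) = (1 - t) ^+ (4 * m.+1)).
    by rewrite exprM [in RHS]exprM; congr (_ ^+ _); ring.
  rewrite !expr_div_n; set a := 1 - t; have bn0 : 1 + t != 0 by clear -t0; lra.
  have e24 : (24 * m = (24 * m - 4 * m.+1 - 4 * j) + 4 * j + 4 * m.+1)%N by lia.
  rewrite [in LHS]e24; move: (24 * m - 4 * m.+1 - 4 * j)%N (4 * j)%N (4 * m.+1)%N.
  move=> k1 k2 k3; rewrite !exprD; field.
  by rewrite !expf_neq0.
move=> /dvdp_comp_pow4; rewrite hq Gauss_dvdpl; last first.
  by apply/coprimep_expr/coprimep_expl; rewrite coprimep_sym coprimep_XsubC rootE !hornerE.
have [->|q0] := eqVneq q 0; first by rewrite mul0r.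
by move=> /(dvdp_leq q0); rewrite size_exp_XsubC => /leq_trans/(_ szq); lia.
Qed.

Lemma Poly_cons (R : nzRingType) (a : R) (s : seq R) : Poly (a :: s) = Poly s * 'X + a%:P.
Proof. by rewrite /= cons_poly_def. Qed.

Lemma Poly_nil (R : nzRingType) : Poly [::] = 0 :> {poly R}.
Proof. by []. Qed.

Lemma gleason_f_expand (R : comNzRingType) : (1 + 14%:R *: 'X + 'X^2) ^+ 3 =
  Poly [:: 1; 42; 591; 2828; 591; 42; 1] :> {poly R}.
Proof.
rewrite !Poly_cons Poly_nil mul0r add0r -mul_polyC !polyC_natr polyC1; ring.
Qed.

Lemma gleason_g_expand (R : comNzRingType) : 'X * (1 - 'X) ^+ 4 =
  Poly [:: 0; 1; -4; 6; -4; 1] :> {poly R}.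
Proof.
rewrite !Poly_cons Poly_nil mul0r add0r !polyCN !polyC_natr polyC0 polyC1; ring.
Qed.

Lemma size_gleason_f : (size gleason_f <= 7)%N.
Proof. by rewrite /gleason_f gleason_f_expand; apply: size_Poly. Qed.

Lemma size_gleason_g : (size gleason_g <= 6)%N.
Proof. by rewrite /gleason_g gleason_g_expand; apply: size_Poly. Qed.

(** The product f^(m - r) g^r begins with X^r, so a triangular elimination cancels the coefficients
    of index at most m. The remainder is zero by [selfdual_poly_low0]. *)
Lemma gleason_span m h : selfdual_poly m h -> (size h <= (6 * m).+1)%N ->
  exists a : nat -> rat,
    h = \sum_(r < m.+1) a r *: (gleason_f ^+ (m - r) * gleason_g ^+ r).
Proof.
move=> ih sz; pose e r := gleason_f ^+ (m - r) * gleason_g ^+ r.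
have coefe r i : (i <= r)%N -> (e r)`_i = (i == r)%:R.
  move=> ir; rewrite /e /gleason_g [('X * _) ^+ r]exprMn mulrCA coefXnM; case: ltngtP ir => // -> _.
  rewrite subnn -horner_coef0 /gleason_f.
  rewrite !(hornerM, horner_exp, hornerD, hornerN, hornerZ, hornerX, hornerXn, hornerC).
  by rewrite ?expr0n !mulr0 oppr0 !addr0 !expr1n mulr1.
have size_e r : (r <= m)%N -> (size (e r) <= (6 * m).+1)%N.
  move=> rm; apply: leq_trans (size_polyMleq _ _) _.
  have h1 : (size (gleason_f ^+ (m - r)) <= (6 * (m - r)).+1)%N.
    apply: leq_trans (size_poly_exp_leq _ _) _; rewrite ltnS leq_mul2r; apply/orP; right.
    by have := size_gleason_f; lia.
  have h2 : (size (gleason_g ^+ r) <= (5 * r).+1)%N.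
    apply: leq_trans (size_poly_exp_leq _ _) _; rewrite ltnS leq_mul2r; apply/orP; right.
    by have := size_gleason_g; lia.
  by lia.
suff [a ha] : exists a : nat -> rat, forall i, (i < m.+1)%N ->
    (h - \sum_(r < m.+1) a r *: e r)`_i = 0.
  exists a; apply/eqP; rewrite -subr_eq0; apply/eqP.
  apply: (@selfdual_poly_low0 m) => //.
    apply: (big_rec (fun p => selfdual_poly m (h - p))) => [|r p _ ip]; first by rewrite subr0.
    rewrite [_ *: _ + _]addrC opprD addrA; apply: selfdual_polyB => //.
    by apply: selfdual_poly_gleason; rewrite -ltnS.
  apply: leq_trans (size_polyD _ _) _; rewrite geq_max sz size_polyN /=.
  apply: leq_trans (size_sum _ _ _) _; apply/bigmax_leqP => r _.
  by apply: leq_trans (size_scale_leq _ _) _; apply: size_e; rewrite -ltnS.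
elim: m.+1 => [|j [a IH]]; first by exists (fun=> 0).
pose c := (h - \sum_(r < j) a r *: e r)`_j.
exists (fun r => if (r == j)%N then c else a r) => i ij.
rewrite big_ord_recr /= eqxx opprD addrA coefB coefZ (coefe j i) //.
rewrite (eq_bigr (fun r : 'I_j => a r *: e r)) => [|r _]; last by rewrite ltn_eqF.
move: ij; rewrite ltnS leq_eqVlt => /orP[/eqP->|ij]; first by rewrite eqxx mulr1 subrr.
by rewrite IH // ltn_eqF // mulr0 subr0.
Qed.

(** * Residues *)

(* The coefficient of X^k in the power series P / (1 - X)^(M + 1). *)
Definition div1X_coef (M k : nat) (P : {poly rat}) : rat :=
  \sum_(j < k.+1) P`_j * 'C(M + (k - j), M)%:R.

Lemma div1X_coefD M k P Q : div1X_coef M k (P + Q) = div1X_coef M k P + div1X_coef M k Q.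
Proof. by rewrite -big_split; apply: eq_bigr => j _; rewrite coefD mulrDl. Qed.

Lemma div1X_coefZ M k c P : div1X_coef M k (c *: P) = c * div1X_coef M k P.
Proof. by rewrite mulr_sumr; apply: eq_bigr => j _; rewrite coefZ mulrA. Qed.

Lemma div1X_coef0 M k : div1X_coef M k 0 = 0.
Proof. by rewrite -(scale0r 0) div1X_coefZ mul0r. Qed.

Lemma div1X_coefN M k P : div1X_coef M k (- P) = - div1X_coef M k P.
Proof. by rewrite -scaleN1r div1X_coefZ mulN1r. Qed.

Lemma div1X_coef_sum M k (I : Type) (r : seq I) (F : I -> {poly rat}) :
  div1X_coef M k (\sum_(i <- r) F i) = \sum_(i <- r) div1X_coef M k (F i).
Proof. exact: (big_morph _ (div1X_coefD M k) (div1X_coef0 M k)). Qed.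

Lemma div1X_coefX M k P :
  div1X_coef M k ('X * P) = \sum_(j < k) P`_j * 'C(M + (k - j.+1), M)%:R.
Proof.
rewrite /div1X_coef big_ord_recl coefXM mul0r add0r.
by apply: eq_bigr => j _; rewrite coefXM.
Qed.

Lemma div1X_coef_Xn M k r P : div1X_coef M (k + r) ('X^r * P) = div1X_coef M k P.
Proof.
elim: r P => [|r IH] P; first by rewrite addn0 expr0 mul1r.
rewrite exprS -mulrA addnS div1X_coefX -[RHS]IH.
by apply: eq_bigr => j _; rewrite subSS.
Qed.

(** Cancelling one factor 1 - X of the denominator is Pascal's rule. *)
Lemma div1X_coef_mul1X M k P : div1X_coef M.+1 k ((1 - 'X) * P) = div1X_coef M k P.
Proof.
rewrite mulrBl mul1r div1X_coefD div1X_coefN div1X_coefX /div1X_coef.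
rewrite !big_ord_recr /= subnn !addn0 !binn addrAC; congr (_ + _).
rewrite -sumrB; apply: eq_bigr => j _; rewrite -mulrBr; congr (_ * _).
have -> : (k - j = (k - j.+1).+1)%N by have := ltn_ord j; lia.
by rewrite addnS binS addSnnS addnS natrD addrAC subrr add0r.
Qed.

Lemma div1X_coef_mul1Xn M k n P :
  div1X_coef (M + n) k ((1 - 'X) ^+ n * P) = div1X_coef M k P.
Proof.
elim: n P => [|n IH] P; first by rewrite addn0 expr0 mul1r.
by rewrite addnS exprS -mulrA div1X_coef_mul1X.
Qed.

(* Both sides are the coefficient of X^k in X (P / (1 - X)^(M + 1))'. *)
Lemma div1X_coef_deriv M k P :
  k%:R * div1X_coef M k P =
    div1X_coef M k ('X * P^`()) + M.+1%:R * div1X_coef M.+1 k ('X * P).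
Proof.
have XP' j : ('X * P^`())`_j = j%:R * P`_j.
  by rewrite coefXM; case: j => [|j]; rewrite ?mul0r //= coef_deriv mulr_natl.
apply/eqP; rewrite addrC -subr_eq; apply/eqP.
rewrite (div1X_coefX _ _ P) /div1X_coef !mulr_sumr -sumrB big_ord_recr /= XP' mulrA subrr addr0.
apply: eq_bigr => j _; rewrite XP'; have jk := ltn_ord j.
have := mul_bin_left (M + (k - j)) M; rewrite addKn => /(congr1 (fun n => n%:R : rat)).
rewrite !natrM natrB; last exact: ltnW.
have -> : (M.+1 + (k - j.+1) = M + (k - j))%N by lia.
by move=> e; rewrite [RHS]mulrCA e; ring.
Qed.

Lemma deriv_expM (R : comNzRingType) (p : {poly R}) n :
  (p ^+ n)^`() * p = n%:R * (p ^+ n * p^`()).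
Proof.
rewrite deriv_exp; case: n => [|n]; first by rewrite mulr0n !mul0r.
by rewrite exprS -mulr_natl /=; ring.
Qed.

Lemma deriv_poly1 (R : nzRingType) : (1 : {poly R})^`() = 0.
Proof. by rewrite -polyC1 derivC. Qed.

(* With phi = g/f, this is the vanishing of the residue at 0 of d (phi^(- e - 1)). *)
Lemma div1X_coef_jacobian e f :
  div1X_coef (4 * e.+1 + 3) e.+1 (f ^+ e * (gleason_g^`() * f - gleason_g * f^`())) = 0.
Proof.
have -> : f ^+ e * (gleason_g^`() * f - gleason_g * f^`()) =
    (1 - 'X) ^+ 3 * ((1 - 'X) * f ^+ e.+1 + (- 4%:R) *: ('X * f ^+ e.+1)
                       - (1 - 'X) * ('X * (f ^+ e * f^`()))).
  rewrite /gleason_g derivM derivX deriv_exp derivB derivX deriv_poly1 /=.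
  rewrite -mul_polyC polyCN polyC_natr.
  rewrite (exprS f). ring.
rewrite div1X_coef_mul1Xn !(div1X_coefD, div1X_coefN, div1X_coefZ).
rewrite mulnS !div1X_coef_mul1X.
(* For this instance M + 1 = 4 (e + 1) and k = e + 1, so division by e + 1 turns the identity into
   the required cancellation. *)
have := div1X_coef_deriv (4 * e).+3 e.+1 (f ^+ e.+1).
rewrite deriv_exp.
have -> : 'X * (f^`() * f ^+ e.+1.-1 *+ e.+1) = e.+1%:R *: ('X * (f ^+ e * f^`())).
  by rewrite -mul_polyC polyC_natr -mulr_natl /=; ring.
rewrite div1X_coefZ => key.
have en : e.+1%:R != 0 :> rat by rewrite pnatr_eq0.
apply: (mulfI en); rewrite mulr0 !mulrDr key.
have -> : (4 * e).+4%:R = 4 * e.+1%:R :> rat by rewrite -natrM; congr (_%:R); lia.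
by ring.
Qed.

(** Put s = m + d + 1. The polynomial is f^s (h/f^m)', so the coefficient is the residue of d
    (h/f^m) / (g/f)^s. On the spanning element of index r, h/f^m is (g/f)^r and the differential is
    r/(r - s) times d ((g/f)^(r - s)), which is exact since r <= m < s. *)
Lemma gleason_residue m d h : selfdual_poly m h -> (size h <= (6 * m).+1)%N ->
  div1X_coef (4 * (m + d) + 3) (m + d)
    ((h^`() * gleason_f - m%:R *: (h * gleason_f^`())) * gleason_f ^+ d) = 0.
Proof.
move=> ih sz; have [a ->] := gleason_span ih sz; move: gleason_f => f.
pose K p := (p^`() * f - m%:R *: (p * f^`())) * f ^+ d.
have KD p q : K (p + q) = K p + K q.
  by rewrite /K derivD -!mul_polyC; ring.
have K0 : K 0 = 0 by rewrite /K deriv0 !mul0r scaler0 subr0 mul0r.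
rewrite -/(K _) (big_morph K KD K0) div1X_coef_sum big1 // => -[r /= rm] _.
have -> : K (a r *: (f ^+ (m - r) * gleason_g ^+ r)) = a r *: K (f ^+ (m - r) * gleason_g ^+ r).
  by rewrite /K derivZ -!mul_polyC; ring.
rewrite div1X_coefZ; apply/eqP; rewrite mulf_eq0; apply/orP; right; apply/eqP.
(* At r = 0 the exponent [r.-1] is truncated to 0, but the scalar r is 0 and both sides vanish. *)
have -> : K (f ^+ (m - r) * gleason_g ^+ r) = r%:R *:
    (f ^+ (m - r + d) * gleason_g ^+ r.-1 * (gleason_g^`() * f - gleason_g * f^`())).
  rewrite /K derivM [(_ + _) * f]mulrDl [_ * f in X in X - _]mulrAC deriv_expM.
  have -> : m%:R = (m - r)%:R + r%:R :> rat by rewrite -natrD subnK.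
  case: r rm => [|r] rm /=; rewrite ?expr0 -!mul_polyC polyCD !polyC_natr exprD.
    by rewrite deriv_poly1; ring.
  by rewrite deriv_exp /= -mulr_natl exprS; ring.
rewrite div1X_coefZ; case: r rm => [|r] rm /=; first by rewrite mul0r.
rewrite [gleason_g in gleason_g ^+ r]/gleason_g [('X * _) ^+ r]exprMn -(exprM _ 4 r).
pose e := (m - r.+1 + d)%N.
have -> : (m + d = e.+1 + r)%N by rewrite /e; lia.
rewrite -/e; set J := gleason_g^`() * f - _.
have -> : f ^+ e * ('X ^+ r * (1 - 'X) ^+ (4 * r)) * J =
    'X^r * ((1 - 'X) ^+ (4 * r) * (f ^+ e * J)) by ring.
have -> : (4 * (e.+1 + r) + 3 = 4 * e.+1 + 3 + 4 * r)%N by lia.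
by rewrite div1X_coef_Xn div1X_coef_mul1Xn div1X_coef_jacobian mulr0.
Qed.

(* Written in base 1000 since nat literals are unary. *)
Definition coefs_df : seq nat := [:: 42; 1182; 8 * 1000 + 484; 2364; 210; 6]%N.
Definition coefs_fdf : seq nat :=
  [:: 42; 2946; 82 * 1000 + 950; 1176 * 1000 + 30; (8 * 1000 + 481) * 1000 + 60;
      (26 * 1000 + 99) * 1000 + 28; (11 * 1000 + 873) * 1000 + 484; 2352 * 1000 + 60;
      248 * 1000 + 850; 14 * 1000 + 730; 462; 6]%N.

Definition nat_poly (R : nzRingType) (s : seq nat) : {poly R} :=
  foldr (fun n p => n%:R + 'X * p) 0 s.

Lemma coef_nat_poly (R : nzRingType) s j : (nat_poly R s)`_j = (nth 0%N s j)%:R.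
Proof.
elim: s j => [|n s IH] j; first by rewrite coef0 nth_nil.
by rewrite coefD coefXM -polyC_natr coefC; case: j => [|j] /=; rewrite ?addr0 ?add0r.
Qed.

Lemma df_expand (R : comNzRingType) :
  ((1 + 14%:R *: 'X + 'X^2) ^+ 3)^`() = nat_poly R coefs_df.
Proof.
rewrite /nat_poly /coefs_df /foldr deriv_exp !derivD deriv_poly1 derivZ derivX derivXn.
rewrite -!mul_polyC (polyC_natr _ 14) -[(3%N).-1]/(2%N) -[(2%N).-1]/(1%N); ring.
Qed.

Lemma fdf_expand (R : comNzRingType) :
  (1 + 14%:R *: 'X + 'X^2) ^+ 3 * nat_poly R coefs_df = nat_poly R coefs_fdf.
Proof.
rewrite /nat_poly /coefs_df /coefs_fdf /foldr -!mul_polyC (polyC_natr _ 14).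

ring.
Qed.

Definition div1X_nat (M k : nat) (s : seq nat) : nat :=
  (\sum_(j < k.+1) nth 0 s j * 'C(M + (k - j), M))%N.

Lemma div1X_coef_nat_poly M k s :
  div1X_coef M k (nat_poly _ s) = (div1X_nat M k s)%:R.
Proof.
rewrite natr_sum; apply: eq_bigr => j _; rewrite natrM; congr (_ * _).
exact: coef_nat_poly.
Qed.

(** * The residue equations of an extremal enumerator *)

Lemma coef1M (p q : {poly rat}) : (p * q)`_1 = p`_0 * q`_1 + p`_1 * q`_0.
Proof. by rewrite coefM !big_ord_recl big_ord0 addr0. Qed.

Lemma coef_f0 : gleason_f`_0 = 1.
Proof. by rewrite /gleason_f gleason_f_expand coef_Poly. Qed.

Lemma coef_f1 : gleason_f`_1 = 42.
Proof. by rewrite /gleason_f gleason_f_expand coef_Poly. Qed.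

Lemma low_coef_split m (h : {poly rat}) : h`_0 = 1 -> (forall i, (0 < i <= m)%N -> h`_i = 0) ->
  h = 1 + 'X^(m.+1) * drop_poly m.+1 h.
Proof.
move=> h0 hl; rewrite -[h in LHS](poly_take_drop m.+1) mulrC; congr (_ + _).
apply/polyP => i; rewrite coef_take_poly coef1.
by case: i => [|i]; [rewrite h0 | case: ltnP => // im; rewrite hl].
Qed.

(** In h = 1 + X^(m+1) q the term 1 yields the right side. The other term carries a factor X^m, so
    only the coefficients of q of index at most d remain. *)
Lemma extremal_residue m d h : selfdual_poly m h -> (size h <= (6 * m).+1)%N ->
  h`_0 = 1 -> (forall i, (0 < i <= m)%N -> h`_i = 0) ->
  let q := drop_poly m.+1 h in
  div1X_coef (4 * (m + d) + 3) d
    ((m.+1%:R *: (q * gleason_f) + 'X * (q^`() * gleason_f - m%:R *: (q * gleason_f^`())))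
      * gleason_f ^+ d) =
  m%:R * div1X_coef (4 * (m + d) + 3) (m + d) (gleason_f ^+ d * gleason_f^`()).
Proof.
move=> ih sz h0 hl q; have := gleason_residue d ih sz.
rewrite {1 2}(low_coef_split h0 hl) -/q; move: gleason_f => f.
have -> : ((1 + 'X^(m.+1) * q)^`() * f - m%:R *: ((1 + 'X^(m.+1) * q) * f^`())) * f ^+ d =
    'X^m * ((m.+1%:R *: (q * f) + 'X * (q^`() * f - m%:R *: (q * f^`()))) * f ^+ d)
    + (- m%:R) *: (f ^+ d * f^`()).
  rewrite derivD deriv_poly1 derivM derivXn -!mul_polyC polyCN !polyC_natr /= exprS.
  by rewrite -mulr_natl; ring.
rewrite div1X_coefD div1X_coefZ [(m + d)%N]addnC div1X_coef_Xn mulNr.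
by move/eqP; rewrite subr_eq0 => /eqP.
Qed.

Lemma extremal_coefs m h (a b : nat) : selfdual_poly m h -> (size h <= (6 * m).+1)%N ->
    h`_0 = 1 -> (forall i, (0 < i <= m)%N -> h`_i = 0) ->
    h`_m.+1 = a%:R -> h`_m.+2 = b%:R ->
  (m.+1 * a = m * div1X_nat (4 * m + 3) m coefs_df)%N /\
  (m.+2 * b + a * (4 * m * m + 54 * m + 92) = m * div1X_nat (4 * m + 7) m.+1 coefs_fdf)%N.
Proof.
move=> ih sz h0 hl ha hb; set q := drop_poly m.+1 h.
have q0 : q`_0 = a%:R by rewrite coef_drop_poly.
have q1 : q`_1 = b%:R by rewrite coef_drop_poly.
have df0 : gleason_f^`()`_0 = 42 by rewrite coef_deriv coef_f1.
split; apply/eqP; rewrite -(eqr_nat rat).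
  have := extremal_residue 0 ih sz h0 hl; rewrite -/q /= addn0 expr0 mulr1 mul1r.
  rewrite {1}/div1X_coef big_ord_recl big_ord0 addr0 addn0 binn mulr1.
  rewrite coefD coefZ coef0M coefXM q0 coef_f0 mulr1 addr0.
  rewrite /gleason_f df_expand div1X_coef_nat_poly => e.
  by rewrite !natrM e.
(* The coefficients of index 0 and 1 have weights 4m + 8 and 1. As f starts with 1 + 42 X, the
   number a is multiplied by (m + 1) (4m + 8) + 42 (m + 1) + 42 = 4m^2 + 54m + 92. *)
have := extremal_residue 1 ih sz h0 hl; rewrite -/q /= expr1.
have -> : (4 * (m + 1) + 3 = 4 * m + 7)%N by lia.
have -> : div1X_coef (4 * m + 7) (m + 1) (gleason_f * gleason_f^`()) =
    (div1X_nat (4 * m + 7) m.+1 coefs_fdf)%:R.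
  by rewrite /gleason_f df_expand fdf_expand div1X_coef_nat_poly addn1.
move: coef_f0 coef_f1 df0; move: gleason_f => f f0 f1 df0.
rewrite /div1X_coef !big_ord_recl big_ord0 addr0 /= subn0 subnn addn0 binn.
rewrite coef0M coef1M !coefD !coefZ !coefXM /= coefB coefZ !coef0M coef1M coef_deriv.
rewrite q0 q1 f0 f1 df0 addn1 binSn natrD !natrM => <-.
apply/eqP; rewrite -!natr1 !natrD !natrM; ring.
Qed.

(** * Extremal codes *)

Definition num_weight n (C : {vspace 'rV['F_2]_n}) (w : nat) : nat :=
  #|[set c in C | wt c == w]|.

Definition quartic_enum m (C : {vspace 'rV['F_2]_(24 * m)}) : {poly rat} :=
  \poly_(k < (6 * m).+1) (num_weight C (4 * k))%:R.

Lemma quartic_enumE m (C : {vspace 'rV['F_2]_(24 * m)}) (t : rat) : doubly_even C ->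
  (quartic_enum C).[t ^+ 4] = \sum_(c in C) t ^+ wt c.
Proof.
move=> de; rewrite horner_poly.
transitivity (\sum_(c in C) \sum_(k < (6 * m).+1) if wt c == (4 * k)%N then t ^+ (4 * k) else 0).
  rewrite exchange_big; apply: eq_bigr => k _ /=.
  rewrite -exprM -big_mkcondr sumr_const mulr_natl; congr (_ *+ _).
  by apply: eq_card => c; rewrite !inE.
apply: eq_bigr => c cC; have /dvdnP[k wk] := de c cC; rewrite (mulnC k) in wk.
have km : (k < (6 * m).+1)%N by have := wt_le c; rewrite wk; lia.
rewrite (bigD1 (Ordinal km)) //= wk eqxx big1 ?addr0 // => j.
by rewrite eqn_pmul2l // eq_sym => /negbTE h; rewrite ifF // -h.
Qed.

Lemma quartic_enum_selfdual m (C : {vspace 'rV['F_2]_(24 * m)}) :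
  self_dual C -> doubly_even C -> selfdual_poly m (quartic_enum C).
Proof.
move=> sd de t tN1; rewrite !quartic_enumE //.
rewrite (macwilliams_eval _ tN1) -sd (@card_self_dual_half _ (12 * m)) //; last by lia.
by rewrite natrX; congr (_ * _); apply: eq_bigl => c; rewrite inE.
Qed.

Lemma supp_inj n : injective (@supp n).
Proof.
move=> u v /setP uv; apply/rowP => i; have := uv i; rewrite !inE.
by case: (F2P (u 0 i)) => ->; case: (F2P (v 0 i)) => ->.
Qed.

Lemma card_support_design n (C : {vspace 'rV['F_2]_n}) w :
  #|support_design C w| = num_weight C w.
Proof.
rewrite /support_design card_imset; last exact: supp_inj.
by apply: eq_card => c; rewrite !inE.
Qed.

Lemma inner_supp n (u v : 'rV['F_2]_n) : inner u v = (#|supp u :&: supp v|)%:R.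
Proof.
rewrite -sum1_card natr_sum big_mkcond /=; apply: eq_bigr => i _; rewrite !inE.
by case: (F2P (u 0 i)) => ->; case: (F2P (v 0 i)) => ->; rewrite ?mulr0 ?mul0r ?mulr1.
Qed.

Lemma self_dual_inter_even n (C : {vspace 'rV['F_2]_n}) u v :
  self_dual C -> u \in C -> v \in C -> ~~ odd #|supp u :&: supp v|.
Proof.
move=> sd uC vC; have : u \in dual_code C by rewrite -sd inE.
rewrite inE => /forallP/(_ v); rewrite vC /= inner_supp.
rewrite -Fp_nat_mod // modn2; by case: (odd _).
Qed.

Lemma extremal_equations m (C : {vspace 'rV['F_2]_(24 * m)}) : (0 < m)%N -> extremal_code C ->
  (m.+1 * num_weight C (4 * m + 4) = m * div1X_nat (4 * m + 3) m coefs_df)%N /\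
  (m.+2 * num_weight C (4 * m + 8) + num_weight C (4 * m + 4) * (4 * m * m + 54 * m + 92) =
    m * div1X_nat (4 * m + 7) m.+1 coefs_fdf)%N.
Proof.
move=> m0 [sd de _ [_ dmin]]; have sz : (size (quartic_enum C) <= (6 * m).+1)%N by exact: size_poly.
apply: (extremal_coefs (quartic_enum_selfdual sd de) sz).
- rewrite coef_poly /= muln0; suff -> : num_weight C 0 = 1%N by [].
  rewrite -[RHS](cards1 (0 : 'rV['F_2]_(24 * m))); apply: eq_card => c.
  by rewrite !inE wt_eq0; case: eqP => [->|]; rewrite ?mem0v ?andbF.
- move=> i /andP[i0 im]; rewrite coef_poly; case: ifP => // _; apply/eqP.
  rewrite pnatr_eq0 cards_eq0; apply/eqP/setP => c; rewrite !inE; apply/negP => /andP[cC /eqP wc].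
  have c0 : c != 0 by rewrite -wt_eq0 wc; lia.
  by have := dmin c cC c0; rewrite wc; lia.
- by rewrite coef_poly ifT; [congr (num_weight _ _)%:R; lia | lia].
- by rewrite coef_poly ifT; [congr (num_weight _ _)%:R; lia | lia].
Qed.

Close Scope ring_scope.

(** * Exclusion of large and of small m *)

Lemma div1X_nat_trunc M k s : size s <= k.+1 ->
  div1X_nat M k s = \sum_(j < size s) nth 0 s j * 'C(M + (k - j), M).
Proof.
move=> sk; rewrite /div1X_nat (bigID (fun j : 'I_k.+1 => j < size s)) /= addnC big1 => [|j].
  by rewrite add0n (big_ord_widen _ (fun j => nth 0 s j * 'C(M + (k - j), M)) sk).
by rewrite -leqNgt => /(nth_default 0)->; rewrite mul0n.
Qed.

(** Let S1 and S2 be the two sums. Eliminating a gives (m + 1) (m + 2) b = m ((m + 1) S2 - (4m^2 +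
    54m + 92) S1), whose right side is negative by [zhang_ineq]. *)
Lemma zhang m a b : 154 <= m ->
  m.+1 * a = m * div1X_nat (4 * m + 3) m coefs_df ->
  m.+2 * b + a * (4 * m * m + 54 * m + 92) = m * div1X_nat (4 * m + 7) m.+1 coefs_fdf ->
  False.
Proof.
move=> m154; have [q mq] : exists q, m = q + 154 by exists (m - 154); lia.
move=> e1 e2.
(* Both families have upper index 5m - 3 + r. The binomials multiplying the coefficient of index j
   are [u (11 - j)] and [v (6 - j)]. *)
pose u r := 'C(4 * m + 7 + (q + 144 + r), 4 * m + 7).
pose v r := 'C(4 * m + 3 + (q + 148 + r), 4 * m + 3).
have ru r : u r.+1 * (q + 144 + r + 1) = u r * (5 * q + 767 + r + 1).
  rewrite /u; have := mul_bin_down (4 * m + 7 + (q + 144 + r.+1)) (4 * m + 7).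
  have -> : (4 * m + 7 + (q + 144 + r.+1)).-1 = 4 * m + 7 + (q + 144 + r) by lia.
  have -> : 4 * m + 7 + (q + 144 + r.+1) - (4 * m + 7) = q + 144 + r + 1 by lia.
  have -> : 5 * q + 767 + r + 1 = 4 * m + 7 + (q + 144 + r.+1) by lia.
  by move=> e; rewrite [RHS]mulnC e mulnC.
have rv r : v r * ((q + 144 + r + 1) * (q + 144 + r + 2) * (q + 144 + r + 3) * (q + 144 + r + 4)) =
    u r * ((4 * m + 4) * (4 * m + 5) * (4 * m + 6) * (4 * m + 7)).
  rewrite /u /v; have -> : 4 * m + 3 + (q + 148 + r) = 4 * m + 7 + (q + 144 + r) by lia.
  set N := 4 * m + 7 + (q + 144 + r).
  have := mul_bin_left N (4 * m + 3); have := mul_bin_left N (4 * m + 4).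
  have := mul_bin_left N (4 * m + 5); have := mul_bin_left N (4 * m + 6).
  have -> : N - (4 * m + 3) = q + 144 + r + 4 by lia.
  have -> : N - (4 * m + 4) = q + 144 + r + 3 by lia.
  have -> : N - (4 * m + 5) = q + 144 + r + 2 by lia.
  have -> : N - (4 * m + 6) = q + 144 + r + 1 by lia.
  rewrite -!addnS => h6 h5 h4 h3.
  move: (q + 144 + r + 1) (q + 144 + r + 2) (q + 144 + r + 3) (q + 144 + r + 4) h3 h4 h5 h6.
  move=> x1 x2 x3 x4 h3 h4 h5 h6.
  transitivity (x1 * x2 * x3 * (x4 * 'C(N, 4 * m + 3))); first by ring.
  rewrite -h3; transitivity ((4 * m + 4) * x1 * x2 * (x3 * 'C(N, 4 * m + 4)));
    first by ring.
  rewrite -h4; transitivity ((4 * m + 4) * (4 * m + 5) * x1 * (x2 * 'C(N, 4 * m + 5)));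
    first by ring.
  rewrite -h5; transitivity ((4 * m + 4) * (4 * m + 5) * (4 * m + 6) * (x1 * 'C(N, 4 * m + 6)));
    first by ring.
  by rewrite -h6; ring.
have u0 : 0 < u 0 by rewrite bin_gt0; lia.
have hv r : (Z.of_nat (v r) * rising (Z.of_nat q + 154 - 10 + Z.of_nat r) 4 =
    Z.of_nat (u r) * rising (4 * (Z.of_nat q + 154) + 3) 4)%coqZ.
  have := rv r; rewrite mq; cbn [rising]; move: (u r) (v r) => ur vr.
  move=> H; clear -H; lia.
have zi := @zhang_ineq (Z.of_nat q) (fun r => Z.of_nat (u r)) (fun r => Z.of_nat (v r)).
have {}zi := zi ltac:(lia) ltac:(lia).
have {}zi : _ := zi ltac:(move=> r; have := ru r; lia) hv.
have s1 : div1X_nat (4 * m + 3) m coefs_df = \sum_(j < 6) nth 0 coefs_df j * v (6 - j).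
  rewrite div1X_nat_trunc; last by rewrite mq /=; lia.
  by apply: eq_bigr => -[j /= j6] _; congr (_ * 'C(_ + _, _)); lia.
have s2 : div1X_nat (4 * m + 7) m.+1 coefs_fdf = \sum_(j < 12) nth 0 coefs_fdf j * u (11 - j).
  rewrite div1X_nat_trunc; last by rewrite mq /=; lia.
  by apply: eq_bigr => -[j /= j12] _; congr (_ * 'C(_ + _, _)); lia.
rewrite !big_ord_recl !big_ord0 /= /bump !leq0n !add1n !subSS !subn0 in s1 s2.
set S1 := div1X_nat _ _ _ in e1 s1; set S2 := div1X_nat _ _ _ in e2 s2.
have lt12 : m.+1 * S2 < (4 * m * m + 54 * m + 92) * S1.
  clear -zi s1 s2 mq; move: zi s1 s2; rewrite mq; lia.
nia.
Qed.

Lemma Z_of_natM a b : Z.of_nat (a * b) = (Z.of_nat a * Z.of_nat b)%coqZ.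
Proof. exact: Nat2Z.inj_mul. Qed.

Lemma Z_of_nat_ffact n k : Z.of_nat (n ^_ k) = falling (Z.of_nat n) k.
Proof.
elim: k => [|k IH]; first by [].
rewrite ffactnSr; cbn [falling]; rewrite -IH; case: (leqP k n) => kn.
  by move: (n ^_ k) => c; nia.
by rewrite ffact_small // mul0n.
Qed.

Lemma Z_of_nat_fact k : Z.of_nat k`! = factZ k.
Proof. by elim: k => [|k IH] //; rewrite factS /= -IH; lia. Qed.

(** One step raises both indices of binomial(5i + 3, i), and four more raise only the upper one. *)
Lemma binomial_step_Z i :
  (Z.of_nat 'C(5 * i.+1 + 3, i.+1) *
     ((Z.of_nat i + 1) * ((4 * Z.of_nat i + 4) * (4 * Z.of_nat i + 5)
      * (4 * Z.of_nat i + 6) * (4 * Z.of_nat i + 7))) =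
   Z.of_nat 'C(5 * i + 3, i) * ((5 * Z.of_nat i + 4) * (5 * Z.of_nat i + 5) * (5 * Z.of_nat i + 6)
      * (5 * Z.of_nat i + 7) * (5 * Z.of_nat i + 8)))%coqZ.
Proof.
have down n k c : k + c = n.+1 -> c * 'C(n.+1, k) = n.+1 * 'C(n, k).
  by move=> e; have := mul_bin_down n.+1 k => /= ->; congr (_ * _); lia.
have e1 := down (5 * i + 7) i.+1 (4 * i + 7) ltac:(lia).
have e2 := down (5 * i + 6) i.+1 (4 * i + 6) ltac:(lia).
have e3 := down (5 * i + 5) i.+1 (4 * i + 5) ltac:(lia).
have e4 := down (5 * i + 4) i.+1 (4 * i + 4) ltac:(lia).
have e5 : i.+1 * 'C(5 * i + 4, i.+1) = (5 * i + 4) * 'C(5 * i + 3, i).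
  by have := mul_bin_diag (5 * i + 4) i; rewrite addnS /= => <-.
rewrite -!addnS in e1 e2 e3 e4.
have -> : 5 * i.+1 + 3 = 5 * i + 8 by lia.
suff : 'C(5 * i + 8, i.+1) * (i.+1 * ((4 * i + 4) * (4 * i + 5) * (4 * i + 6) * (4 * i + 7))) =
   'C(5 * i + 3, i) * ((5 * i + 4) * (5 * i + 5) * (5 * i + 6) * (5 * i + 7) * (5 * i + 8)) by lia.
move: e1 e2 e3 e4 e5; move: 'C(5 * i + 8, i.+1) 'C(5 * i + 7, i.+1) => c8 c7.
move: 'C(5 * i + 6, i.+1) 'C(5 * i + 5, i.+1) => c6 c5.
move: 'C(5 * i + 4, i.+1) 'C(5 * i + 3, i) => c4 c3 e1 e2 e3 e4 e5.
transitivity (i.+1 * (4 * i + 4) * (4 * i + 5) * (4 * i + 6) * ((4 * i + 7) * c8)); first by ring.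
rewrite e1; transitivity (i.+1 * (4 * i + 4) * (4 * i + 5) * (5 * i + 8) * ((4 * i + 6) * c7));
  first by ring.
rewrite e2; transitivity (i.+1 * (4 * i + 4) * (5 * i + 7) * (5 * i + 8) * ((4 * i + 5) * c6));
  first by ring.
rewrite e3; transitivity (i.+1 * (5 * i + 6) * (5 * i + 7) * (5 * i + 8) * ((4 * i + 4) * c5));
  first by ring.
rewrite e4; transitivity ((5 * i + 5) * (5 * i + 6) * (5 * i + 7) * (5 * i + 8) * (i.+1 * c4));
  first by ring.
by rewrite e5; ring.
Qed.

Lemma no_small_parameters m a lam K (L : nat -> nat) : 0 < m <= 153 ->
  m.+1 * a = m * div1X_nat (4 * m + 3) m coefs_df ->
  (forall s, s <= 8 -> L s * (4 * m + 4 - s) ^_ (8 - s) = lam * (24 * m - s) ^_ (8 - s)) ->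
  L 0 = a ->
  231 * ('C(4 * m + 3, 0) * L 2) + 210 * ('C(4 * m + 3, 2) * L 4)
      + 112 * ('C(4 * m + 3, 4) * L 6) + 16 * ('C(4 * m + 3, 6) * L 8) =
    1024 * K + (231 * ('C(4 * m + 3, 1) * L 3) + 168 * ('C(4 * m + 3, 3) * L 5)
      + 56 * ('C(4 * m + 3, 5) * L 7)) ->
  False.
Proof.
move=> /andP[m0 m153] ea hL L0 hK.
have := @none_admissible_sound (fun i => Z.of_nat 'C(5 * i + 3, i)) 153 1 binomial_step_Z
  none_admissible_le_153 m ltac:(lia).
(* For j > m the truncated m - j would give the value 1, whereas the recurrence and the sum require
   0. This matters when m < 5. *)
pose b j := if j <= m then 'C(4 * m + 3 + (m - j), 4 * m + 3) else 0.
have -> : 'C(5 * m + 3, m) = b 0.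
  rewrite /b leq0n subn0 -bin_sub; last by lia.
  by congr 'C(_, _); lia.
suff -> : admissible (Z.of_nat m) (Z.of_nat (b 0)) = true by [].
apply: (@admissible_complete _ (Z.of_nat a) (Z.of_nat lam) (Z.of_nat K) (fun j => Z.of_nat (b j))
  (fun l => Z.of_nat 'C(4 * m + 3, l)) (fun s => Z.of_nat (L s))).
- by lia.
- move=> j _; rewrite /b; case: (ltngtP j m) => jm.
  + have := mul_bin_down (4 * m + 3 + (m - j)) (4 * m + 3).
    have -> : (4 * m + 3 + (m - j)).-1 = 4 * m + 3 + (m - j.+1) by lia.
    have -> : 4 * m + 3 + (m - j) - (4 * m + 3) = m - j by lia.
    move: 'C(_, _) 'C(_, _) => c1 c2 e; nia.
  + by [].
  + by rewrite jm; lia.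
(* Both sums extend to m + 7 terms: [b] vanishes beyond m and the coefficients vanish from index 6
   on. This covers m < 5 as well. *)
- have S6 : div1X_nat (4 * m + 3) m coefs_df = \sum_(j < 6) nth 0 coefs_df j * b j.
    pose F j := nth 0 coefs_df j * b j.
    transitivity (\sum_(j < m.+1 + 6) F j).
      rewrite big_split_ord /= [X in _ = _ + X]big1 => [|j _]; last first.
        by rewrite /F /b ifF ?muln0 //; lia.
      by rewrite addn0; apply: eq_bigr => -[j jm] _; rewrite /F /b /= -ltnS jm.
    rewrite addnC big_split_ord /= [X in _ + X]big1 ?addn0 // => j _.
    by rewrite /F nth_default ?mul0n //=; lia.
  rewrite !big_ord_recl !big_ord0 /= /bump !leq0n !add1n in S6.
  move: ea; rewrite S6; lia.
- have := hL 0 isT; rewrite L0 !subn0 => /(congr1 Z.of_nat).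
  rewrite Z_of_natM [RHS]Z_of_natM !Z_of_nat_ffact.
  by congr (_ * falling _ _ = _ * falling _ _)%coqZ; lia.
- move=> s s8; have := hL s ltac:(lia) => /(congr1 Z.of_nat).
  rewrite Z_of_natM [RHS]Z_of_natM !Z_of_nat_ffact.
  by congr (_ * falling _ _ = _ * falling _ _)%coqZ; lia.
- move=> l; rewrite -Z_of_nat_fact -Z_of_natM bin_ffact Z_of_nat_ffact; congr (falling _ _); lia.
by rewrite /parity_sum; lia.
Qed.

Theorem theorem6 (m : nat) (C : {vspace 'rV['F_2]_(24 * m)}) :
  0 < m -> extremal_code C ->
  ~ is_t_design 8 (support_design C (4 * m + 4)).
Proof.
move=> m0 ext [k [lam [Bk Bt]]].
have [e1 e2] := extremal_equations m0 ext.
have [m154|m153] := leqP 154 m; first exact: zhang m154 e1 e2.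
case: ext => sd _ _ [[c [cC _ wc]] _].
pose B := support_design C (4 * m + 4).
have Bd b : b \in B -> #|b| = 4 * m + 4.
  by move=> /imsetP[u]; rewrite inE => /andP[_ /eqP wu] ->.
have b0B : supp c \in B by apply/imsetP; exists c; rewrite // inE cC wc /=.
have Beven b : b \in B -> ~~ odd #|b :&: supp c|.
  by move=> /imsetP[u]; rewrite inE => /andP[uC _] ->; exact: self_dual_inter_even sd uC cC.
have d8 : 8 <= 4 * m + 4 < #|'I_(24 * m)| by rewrite card_ord; lia.
have [K [L [hL hK]]] := design_parity Bd Bt b0B d8 Beven.
rewrite card_ord in hL.
have dE : 4 * m + 4 - 1 = 4 * m + 3 by lia.
rewrite !dE in hK.
(* The double count for the empty set identifies [L 0] with the number of all blocks. *)
have L0 : L 0 = num_weight C (4 * m + 4).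
  rewrite -card_support_design -/B.
  have := hL 0 isT; rewrite -[in RHS](card_ord (24 * m)) .
  have := @card_blocks_above _ B 8 (4 * m + 4) lam set0 Bd Bt; rewrite cards0 => /(_ isT) <-.
  rewrite !subn0 => /eqP; rewrite eqn_pmul2r; last by rewrite ffact_gt0; lia.
  by move=> /eqP ->; apply: eq_card => b; rewrite inE sub0set andbT.
by apply: (@no_small_parameters m _ lam K L) e1 hL L0 hK; lia.
Qed.
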